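(* A loop is $1$-supernilpotent if and only if it is an abelian group. A loop is $2$-supernilpotent if and only if it is a $2$-nilpotent group.
   Context: A loop is an algebra $(Q,\cdot,\backslash,/,1)$ in which $1$ is a two-sided identity for $\cdot$, $a\backslash b$ is the unique solution $x$ of $ax=b$, and $b/a$ is the unique solution $x$ of $xa=b$. A loop ''is a group'' if its multiplication is associative. A group is $2$-nilpotent if it is nilpotent of class at most $2$. A polynomial on an algebra $A$ is a term in the language of $A$ expanded by all elements of $A$ as constants. An $n$-ary polynomial $p$ on $A$ is absorbing at $(e_1,\dots,e_n)\in A^n$ into $e\in A$ if $p(a_1,\dots,a_n)=e$ whenever $a_1,\dots,a_n\in A$ satisfy $a_i=e_i$ for at least one $i$. The algebra $A$ is $k$-supernilpotent if all polynomials on $A$ in at least $k+1$ variables that are absorbing (at any tuple and into any element) are constant (as functions). *)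

(* Defs.v *)
From mathcomp Require Import all_boot.

Set Implicit Arguments.
Unset Strict Implicit.
Unset Printing Implicit Defensive.

(* The two equivalences say that [ldiv a b], resp. [rdiv b a], is the unique
   solution x of a * x = b, resp. of x * a = b. *)
Record loop := Loop {
  carrier :> Type;
  mul : carrier -> carrier -> carrier;
  ldiv : carrier -> carrier -> carrier;
  rdiv : carrier -> carrier -> carrier;
  one : carrier;
  mul1x : forall x, mul one x = x;
  mulx1 : forall x, mul x one = x;
  ldivP : forall a b x, mul a x = b <-> x = ldiv a b;
  rdivP : forall a b x, mul x a = b <-> x = rdiv b a
}.

Arguments one {l}.

Section Polynomials.

Variable Q : loop.

(* Terms in the variables x_0, ..., x_(n-1) over the language of loops
   expanded by a constant for each element of Q. *)
Inductive polynomial (n : nat) : Type :=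
| PVar of 'I_n
| PConst of Q
| POne
| PMul of polynomial n & polynomial n
| PLdiv of polynomial n & polynomial n
| PRdiv of polynomial n & polynomial n.

Fixpoint eval n (p : polynomial n) (a : 'I_n -> Q) : Q :=
  match p with
  | PVar i => a i
  | PConst c => c
  | POne => one
  | PMul s t => mul (eval s a) (eval t a)
  | PLdiv s t => ldiv (eval s a) (eval t a)
  | PRdiv s t => rdiv (eval s a) (eval t a)
  end.

Definition absorbing n (p : polynomial n) (e : 'I_n -> Q) (c : Q) : Prop :=
  forall a : 'I_n -> Q, (exists i, a i = e i) -> eval p a = c.

Definition constant_polynomial n (p : polynomial n) : Prop :=
  exists c : Q, forall a : 'I_n -> Q, eval p a = c.

Definition supernilpotent (k : nat) : Prop :=
  forall (n : nat) (p : polynomial n) (e : 'I_n -> Q) (c : Q),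
    k < n -> absorbing p e c -> constant_polynomial p.

End Polynomials.

Section Groups.

Variable Q : loop.

Definition is_group : Prop := associative (@mul Q).

Definition is_abelian_group : Prop := is_group /\ commutative (@mul Q).

(* The notions below are only used when Q is a group, in which case [inv] is
   the two-sided inverse. *)
Definition inv (x : Q) : Q := ldiv x one.

Definition commutator (x y : Q) : Q := mul (inv x) (mul (inv y) (mul x y)).

Inductive generated (S : Q -> Prop) : Q -> Prop :=
| GenIn x : S x -> generated S x
| GenOne : generated S one
| GenMul x y : generated S x -> generated S y -> generated S (mul x y)
| GenInv x : generated S x -> generated S (inv x).

(* Indexed from 0: the i-th term is the one usually written gamma_(i+1). *)
Fixpoint lower_central (i : nat) : Q -> Prop :=
  match i with
  | 0 => fun _ => True
  | j.+1 => generated (fun z =>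
      exists x y : Q, lower_central j x /\ z = commutator x y)
  end.

Definition is_nilpotent_group (k : nat) : Prop :=
  is_group /\ forall x : Q, lower_central k x -> x = one.

End Groups.

(* Main.v *)
From mathcomp Require Import all_boot.
Require Import Defs.

(** Absorbing polynomials built from the associator and from commutators give
    the forward directions. Conversely, restrict a polynomial to the cube
    whose vertices replace blocks of coordinates of [e] by those of [a], one
    block per direction. In an abelian group the vertices of a square satisfy
    a parallelogram relation; in a group of class 2 the vertices of a
    3-dimensional cube have the form
    [g0 g1^w1 g2^w2 g3^w3 z12^(w1 w2) z13^(w1 w3) z23^(w2 w3)] with central
    [zij]. Families of either form are closed under the group operations, and
    all vertices but one determine the last one. Absorption makes
    all vertices but the one at [a] equal. *)

Set Implicit Arguments.
Unset Strict Implicit.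
Unset Printing Implicit Defensive.

Declare Scope loop_scope.
Local Open Scope loop_scope.
Local Notation "x * y" := (mul x y) : loop_scope.
Local Notation "1" := one : loop_scope.

(** * Loops: associativity and commutativity from absorbing polynomials *)

Section LoopTheory.

Variable Q : loop.
Implicit Types x y z : Q.

Lemma mul_ldiv x y : x * ldiv x y = y.
Proof. exact/ldivP. Qed.

Lemma mulxV x : x * inv x = 1.
Proof. exact: mul_ldiv. Qed.

Lemma ldivxx x : ldiv x x = 1.
Proof. by apply/esym/ldivP; rewrite mulx1. Qed.

Lemma ldiv1x x : ldiv 1 x = x.
Proof. by apply/esym/ldivP; rewrite mul1x. Qed.

Lemma ldiv_eq1 x y : ldiv x y = 1 -> x = y.
Proof. by move/esym/ldivP; rewrite mulx1. Qed.

Lemma inv1 : inv 1 = 1 :> Q.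
Proof. exact: ldiv1x. Qed.

Lemma eval_ext n (p : polynomial Q n) a b : a =1 b -> eval p a = eval p b.
Proof. by move=> ab; elim: p => //= [p -> q ->|p -> q ->|p -> q ->]. Qed.

(** The constant is identified by evaluating at [e]; [k < n] makes [n] positive, so there is a
    coordinate at which to invoke absorption. *)
Lemma absorbing_eq n k (p : polynomial Q n) e c a :
  supernilpotent Q k -> k < n -> absorbing p e c -> eval p a = c.
Proof.
move=> snQ ltkn pe; have [d pd] := snQ n p e c ltkn pe.
have i : 'I_n by apply: Ordinal (leq_ltn_trans (leq0n k) ltkn).
by rewrite pd -(pd e); apply: pe; exists i.
Qed.

Definition triple x y z (i : 'I_3) : Q := nth 1 [:: x; y; z] i.

Definition X0 : polynomial Q 3 := PVar Q (Ordinal (isT : 0 < 3)).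
Definition X1 : polynomial Q 3 := PVar Q (Ordinal (isT : 1 < 3)).
Definition X2 : polynomial Q 3 := PVar Q (Ordinal (isT : 2 < 3)).

Lemma ord3_exists1 (a : 'I_3 -> Q) : (exists i, a i = 1) ->
  [\/ eval X0 a = 1, eval X1 a = 1 | eval X2 a = 1].
Proof.
case=> -[[|[|[|//]]] lti] ai; [constructor 1|constructor 2|constructor 3];
  by rewrite /= -[RHS]ai; congr a; apply: val_inj.
Qed.

(** The two bracketings of a triple product agree as soon as one factor is [1], so their quotient is
    absorbing. Its three variables serve both [k = 1] and [k = 2]. *)
Lemma supernilpotent_group k : k < 3 -> supernilpotent Q k -> is_group Q.
Proof.
move=> ltk3 snQ x y z.
pose p := PLdiv (PMul X0 (PMul X1 X2)) (PMul (PMul X0 X1) X2).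
have absp : absorbing p (fun=> 1) 1.
  move=> a /ord3_exists1.
  rewrite /p; cbn -[X0 X1 X2].
  by case=> ->; rewrite ?mul1x ?mulx1 ?mul1x ?ldivxx.
exact: ldiv_eq1 (absorbing_eq (triple x y z) snQ ltk3 absp).
Qed.

Lemma supernilpotent1_comm : supernilpotent Q 1 -> commutative (@mul Q).
Proof.
move=> snQ x y.
pose Y0 : polynomial Q 2 := PVar Q ord0.
pose Y1 : polynomial Q 2 := PVar Q ord_max.
pose p := PLdiv (PMul Y0 Y1) (PMul Y1 Y0).
have absp : absorbing p (fun=> 1) 1.
  move=> a [i ai].
  have : eval Y0 a = 1 \/ eval Y1 a = 1.
    case: i ai => -[|[|//]] lti ai; [left|right];
      by rewrite /= -[RHS]ai; congr a; apply: val_inj.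
  rewrite /p; cbn -[Y0 Y1].
  by case=> ->; rewrite ?mul1x ?mulx1 ldivxx.
exact: ldiv_eq1
  (absorbing_eq (fun i : 'I_2 => nth 1 [:: x; y] i) snQ (isT : 1 < 2) absp).
Qed.

End LoopTheory.

Arguments X0 {Q}.
Arguments X1 {Q}.
Arguments X2 {Q}.

(** * Groups: commutators, central elements and the abelian case *)

Section GroupTheory.

Variable Q : loop.
Hypothesis mulA : is_group Q.
Implicit Types x y z u v : Q.

Lemma mulVx x : inv x * x = 1.
Proof.
have invK : inv (inv x) = x.
  by rewrite -[LHS]mul1x -(mulxV x) -mulA mulxV mulx1.
by rewrite -[X in _ * X]invK mulxV.
Qed.

Lemma mulKx x y : inv x * (x * y) = y.
Proof. by rewrite mulA mulVx mul1x. Qed.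

Lemma mulVKx x y : x * (inv x * y) = y.
Proof. by rewrite mulA mulxV mul1x. Qed.

Lemma mulxK x y : y * x * inv x = y.
Proof. by rewrite -mulA mulxV mulx1. Qed.

Lemma mulxVK x y : y * inv x * x = y.
Proof. by rewrite -mulA mulVx mulx1. Qed.

Lemma ldivE x y : ldiv x y = inv x * y.
Proof. by apply/esym/(ldivP _ _ _).1; rewrite mulVKx. Qed.

Lemma rdivE x y : rdiv x y = x * inv y.
Proof. by apply/esym/(rdivP _ _ _).1; rewrite mulxVK. Qed.

Lemma mul_injl x y z : x * y = x * z -> y = z.
Proof. by move=> /(congr1 (fun t => inv x * t)); rewrite !mulKx. Qed.

Lemma invM x y : inv (x * y) = inv y * inv x.
Proof. by apply: (@mul_injl (x * y)); rewrite mulxV mulA mulxK mulxV. Qed.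

Lemma commutatorE x y : x * y = y * x * commutator x y.
Proof. by rewrite /commutator -!mulA !mulVKx. Qed.

Lemma commutator1x x : commutator 1 x = 1.
Proof. by rewrite /commutator inv1 !mul1x mulVx. Qed.

Lemma commutatorx1 x : commutator x 1 = 1.
Proof. by rewrite /commutator inv1 mul1x mulx1 mulVx. Qed.

Lemma commutator_eq1 x y : commutator x y = 1 <-> x * y = y * x.
Proof.
split=> [xy1|xyC]; first by rewrite commutatorE xy1 mulx1.
by rewrite /commutator xyC !mulKx mulVx.
Qed.

Definition central z := forall x, z * x = x * z.

Lemma central1 : central 1.
Proof. by move=> x; rewrite mul1x mulx1. Qed.

Lemma centralM u v : central u -> central v -> central (u * v).
Proof. by move=> uC vC x; rewrite -mulA vC !mulA uC. Qed.

Lemma centralV u : central u -> central (inv u).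
Proof. by move=> uC x; apply: (@mul_injl u); rewrite mulVKx mulA uC mulxK. Qed.

Lemma nilpotent2P :
  is_nilpotent_group Q 2 <-> forall x y, central (commutator x y).
Proof.
split=> [[_ gamma2] x y z|commC].
  apply/commutator_eq1/gamma2/GenIn; exists (commutator x y), z; split=> //.
  by apply: GenIn; exists x, y.
split=> // x; elim=> {x} [_ [x [y [+ ->]]]||_ x _ -> _ ->|_ _ ->];
  rewrite ?mul1x ?inv1 //.
(* Central elements form a subgroup; it contains all commutators, hence [lower_central 1]. *)
move=> x_gamma1; apply/commutator_eq1; move: x x_gamma1 y.
apply: generated_ind => [_ [x [y [_ ->]]]||x y _ xC _ yC|x _ xC].
- exact: commC.
- exact: central1.
- exact: centralM.
- exact: centralV.
Qed.

Lemma supernilpotent2_commutator x y z :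
  supernilpotent Q 2 -> commutator (commutator x y) z = 1.
Proof.
move=> snQ.
(* Inverses are spelled as in [inv], so that [evalp] holds by computation. *)
pose comm n (s t : polynomial Q n) :=
  PMul (PLdiv s (POne Q n)) (PMul (PLdiv t (POne Q n)) (PMul s t)).
pose p := comm 3 (comm 3 X0 X1) X2.
have evalp a :
  eval p a = commutator (commutator (eval X0 a) (eval X1 a)) (eval X2 a) by [].
have absp : absorbing p (fun=> 1) 1.
  move=> a /ord3_exists1; rewrite evalp.
  by case=> ->; rewrite !(commutator1x, commutatorx1).
by rewrite -(absorbing_eq (triple x y z) snQ (isT : 2 < 3) absp).
Qed.

(** Here [S] is a subgroup of the power of [Q] over [I] containing the constant families.
    Associativity turns both divisions into products with inverses; closure under [=1] replaces
    functional extensionality. *)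
Lemma eval_closed (I : Type) (S : (I -> Q) -> Prop) n (p : polynomial Q n)
    (A : I -> 'I_n -> Q) :
    (forall x y : I -> Q, x =1 y -> S x -> S y) ->
    (forall c, S (fun=> c)) ->
    (forall x y : I -> Q, S x -> S y -> S (fun w => x w * y w)) ->
    (forall x : I -> Q, S x -> S (fun w => inv (x w))) ->
    (forall i, S (fun w => A w i)) ->
  S (fun w => eval p (A w)).
Proof.
move=> Sext Sconst SM SV SA.
elim: p => [i|c||p Sp q Sq|p Sp q Sq|p Sp q Sq] //=.
- exact: SM.
- by apply: Sext (SM _ _ (SV _ Sp) Sq) => w; rewrite ldivE.
- by apply: Sext (SM _ _ Sp (SV _ Sq)) => w; rewrite rdivE.
Qed.

(** By commutativity, the quadruples satisfying the relation form a subgroup of the fourth power of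
    [Q]. *)
Lemma comm_parallelogram (mulC : commutative (@mul Q)) n
    (p : polynomial Q n) (A : bool * bool -> 'I_n -> Q) :
    (forall i, A (false, false) i * A (true, true) i =
               A (true, false) i * A (false, true) i) ->
  eval p (A (false, false)) * eval p (A (true, true)) =
  eval p (A (true, false)) * eval p (A (false, true)).
Proof.
pose S (x : bool * bool -> Q) :=
  x (false, false) * x (true, true) = x (true, false) * x (false, true).
move=> SA; rewrite -/(S (fun w => eval p (A w))).
apply: eval_closed => //; rewrite /S.
- by move=> x y xy; rewrite !xy.
- have ACA u v z t : u * v * (z * t) = u * z * (v * t).
    by rewrite -!mulA; congr (_ * _); rewrite !mulA (mulC v).
  by move=> x y Sx Sy; rewrite ACA Sx Sy ACA.
- by move=> x Sx; rewrite -!invM; congr inv; rewrite mulC Sx mulC.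
Qed.

Lemma abelian_supernilpotent1 :
  commutative (@mul Q) -> supernilpotent Q 1.
Proof.
move=> mulC n p e c lt1n pe; exists c => a.
(* The blocks are coordinate 0 and all the others. Both are nonempty as [1 < n], so every vertex but
   the top one keeps a coordinate of [e]. *)
pose A (w : bool * bool) (i : 'I_n) :=
  if (if val i == 0 then w.1 else w.2) then a i else e i.
have Ac w : w != (true, true) -> eval p (A w) = c.
  case: w => -[] [] // _; apply: pe.
  - by exists (Ordinal lt1n).
  - by exists (Ordinal (ltnW lt1n)).
  - by exists (Ordinal lt1n).
rewrite (@eval_ext _ _ p a (A (true, true))); last by move=> i; rewrite /A if_same.
(* The relation becomes [c * eval p (A (true, true)) = c * c]. *)
apply: (@mul_injl c); rewrite -{1}(Ac (false, false)) //.
rewrite (@comm_parallelogram mulC n p A); first by rewrite !Ac.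
by move=> i; rewrite /A; case: (val i == 0) => //=; rewrite mulC.
Qed.

(** * Cubes in groups of class at most 2 *)

Section Class2.

Hypothesis commC : forall x y, central (commutator x y).

Definition pow (b : bool) x := if b then x else 1.

Lemma pow1 b : pow b 1 = 1.
Proof. by case: b. Qed.

Lemma powM b x y : pow b (x * y) = pow b x * pow b y.
Proof. by case: b; rewrite /= ?mul1x. Qed.

Lemma powV b x : pow b (inv x) = inv (pow b x).
Proof. by case: b; rewrite /= ?inv1. Qed.

Lemma pow_central b z : central z -> central (pow b z).
Proof. by case: b => // _; apply: central1. Qed.

Lemma pow_commutator b d x y :
  commutator (pow b x) (pow d y) = pow (b && d) (commutator x y).
Proof.
by case: b; case: d; rewrite /= ?commutator1x ?commutatorx1.
Qed.

Lemma pow_conj b x y : inv y * pow b x * y = pow b (inv y * x * y).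
Proof. by case: b; rewrite //= mulx1 mulVx. Qed.

(** No factor has exponent [w1 && w2 && w3]: it could only come from a commutator of weight 3,
    trivial in class 2. The seven parameters match the seven vertices below the top one. *)
Definition cube g0 g1 g2 g3 z12 z13 z23 (w : bool * bool * bool) : Q :=
  let: (w1, w2, w3) := w in
  g0 * (pow w1 g1 * (pow w2 g2 * pow w3 g3)) *
  (pow (w1 && w2) z12 * (pow (w1 && w3) z13 * pow (w2 && w3) z23)).

Definition cube_family (x : bool * bool * bool -> Q) : Prop :=
  exists g0 g1 g2 g3 z12 z13 z23,
    [/\ central z12, central z13, central z23
      & x =1 cube g0 g1 g2 g3 z12 z13 z23].

(* Sorting the factors creates the commutators [[a2, b1]], [[a3, b1]] and
   [[a3, b2]], which are central. *)
Lemma sort_factors a1 a2 a3 b1 b2 b3 u12 u13 u23 v12 v13 v23 :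
    central u12 -> central u13 -> central u23 ->
    central v12 -> central v13 -> central v23 ->
  a1 * (a2 * a3) * (u12 * (u13 * u23)) *
    (b1 * (b2 * b3) * (v12 * (v13 * v23))) =
  a1 * b1 * (a2 * b2 * (a3 * b3)) *
    (u12 * v12 * commutator a2 b1 *
      (u13 * v13 * commutator a3 b1 * (u23 * v23 * commutator a3 b2))).
Proof.
move=> u12C u13C u23C v12C v13C v23C.
have swap x y c r : x * y = y * x * c -> x * (y * r) = y * (x * (c * r)).
  by move=> xyE; rewrite !mulA xyE.
have float z : central z -> forall x r, x * (z * r) = z * (x * r).
  by move=> zC x r; rewrite !mulA zC.
move: (commC a2 b1) (commC a3 b1) (commC a3 b2).
move: (commutatorE a2 b1) (commutatorE a3 b1) (commutatorE a3 b2).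
move: (commutator a2 b1) (commutator a3 b1) (commutator a3 b2).
move=> c12 c13 c23 c12E c13E c23E c12C c13C c23C.
(* The trailing [1] gives even the last factor a tail, as [swap] and [float] require. *)
rewrite -[LHS]mulx1 -[RHS]mulx1 -!mulA.
rewrite !(float _ v12C) !(float _ v13C) !(float _ v23C).
rewrite !(float _ u12C) !(float _ u13C) !(float _ u23C).
rewrite (swap _ _ _ _ c13E) (swap _ _ _ _ c12E) !(float _ c13C).
by rewrite (swap _ _ _ _ c23E) !(float _ c12C) !(float _ c23C).
Qed.

Lemma cube_family_ext (x y : bool * bool * bool -> Q) :
  x =1 y -> cube_family x -> cube_family y.
Proof.
move=> xy [g0 [g1 [g2 [g3 [z12 [z13 [z23 [z12C z13C z23C xE]]]]]]]].
exists g0, g1, g2, g3, z12, z13, z23; split=> // w.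
by rewrite -xy xE.
Qed.

Lemma conjM h x y : inv h * (x * y) * h = inv h * x * h * (inv h * y * h).
Proof. by rewrite -!mulA mulVKx. Qed.

Lemma pull_conj g h a z b t : central z ->
  g * a * z * (h * b * t) = g * h * (inv h * a * h * z * (b * t)).
Proof. by move=> zC; rewrite -!mulA mulVKx (mulA z) zC -mulA. Qed.

(** Moving [h0] next to [g0] conjugates the [g]-directions by [h0]. Sorting then creates commutators
    that the central parameters absorb. *)
Lemma cube_familyM (x y : bool * bool * bool -> Q) :
  cube_family x -> cube_family y ->
  cube_family (fun w => x w * y w).
Proof.
move=> [g0 [g1 [g2 [g3 [z12 [z13 [z23 [z12C z13C z23C xE]]]]]]]].
move=> [h0 [h1 [h2 [h3 [t12 [t13 [t23 [t12C t13C t23C yE]]]]]]]].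
pose k1 := inv h0 * g1 * h0; pose k2 := inv h0 * g2 * h0.
pose k3 := inv h0 * g3 * h0.
exists (g0 * h0), (k1 * h1), (k2 * h2), (k3 * h3).
exists (z12 * t12 * commutator k2 h1), (z13 * t13 * commutator k3 h1).
exists (z23 * t23 * commutator k3 h2).
split; try by apply: centralM (commC _ _); apply: centralM.
move=> [[w1 w2] w3]; rewrite xE yE /cube !(powM _ (_ * _) (commutator _ _)).
rewrite (powM _ k1) (powM _ k2) (powM _ k3) (powM _ z12) (powM _ z13) (powM _ z23).
(* [sort_factors] puts the higher index first in its commutators, so the exponents are flipped to
   match. *)
rewrite (andbC w1 w2) (andbC w1 w3) (andbC w2 w3) -!pow_commutator.
rewrite -[RHS]mulA -sort_factors; try exact: pow_central.
rewrite -!pow_conj -!conjM; apply: pull_conj.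
by do !apply: centralM; apply: pow_central.
Qed.

(** The inverse is the reversed product of the inverted factors, each a cube with a single
    nontrivial parameter, so closure under products suffices. *)
Lemma cube_familyV (x : bool * bool * bool -> Q) :
  cube_family x -> cube_family (fun w => inv (x w)).
Proof.
move=> [g0 [g1 [g2 [g3 [z12 [z13 [z23 [z12C z13C z23C xE]]]]]]]].
have cubeC h0 h1 h2 h3 t12 t13 t23 : central t12 -> central t13 ->
  central t23 -> cube_family (cube h0 h1 h2 h3 t12 t13 t23).
  by move=> *; exists h0, h1, h2, h3, t12, t13, t23.
have C1 := central1.
have : cube_family (fun w => cube 1 1 1 1 1 1 (inv z23) w *
  (cube 1 1 1 1 1 (inv z13) 1 w * (cube 1 1 1 1 (inv z12) 1 1 w *
  (cube 1 1 1 (inv g3) 1 1 1 w * (cube 1 1 (inv g2) 1 1 1 1 w *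
  (cube 1 (inv g1) 1 1 1 1 1 w * cube (inv g0) 1 1 1 1 1 1 w)))))).
  do 6!(apply: cube_familyM; first by apply: cubeC => //; apply: centralV).
  exact: cubeC.
apply: cube_family_ext => -[[w1 w2] w3].
rewrite xE /cube !pow1 ?(mul1x, mulx1) !powV !invM -!mulA //.
Qed.

Lemma class2_supernilpotent2 : supernilpotent Q 2.
Proof.
move=> n p e c lt2n pe; exists c => a.
(* The blocks are coordinate 0, coordinate 1 and the rest, all nonempty as [2 < n]. *)
pose A (w : bool * bool * bool) (i : 'I_n) :=
  if (if val i == 0 then w.1.1 else if val i == 1%N then w.1.2 else w.2)
  then a i else e i.
have Ac w : w != (true, true, true) -> eval p (A w) = c.
  case: w => -[w1 w2] w3 wN; apply: pe.
  have [/eqP w1F|w1T] := boolP (w1 == false).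
    by exists (Ordinal (ltnW (ltnW lt2n))); rewrite /A /= w1F.
  have [/eqP w2F|w2T] := boolP (w2 == false).
    by exists (Ordinal (ltnW lt2n)); rewrite /A /= w2F.
  by exists (Ordinal lt2n); case: w1 w2 w3 w1T w2T wN => -[] [].
have [g0 [g1 [g2 [g3 [z12 [z13 [z23 [_ _ _ AE]]]]]]]] :
    cube_family (fun w => eval p (A w)).
  apply: eval_closed => [x y|d|x y|x|i].
  - exact: cube_family_ext.
  - exists d, 1, 1, 1, 1, 1, 1; split=> [|||[[w1 w2] w3]]; try exact: central1.
    by rewrite /cube !pow1 !mulx1.
  - exact: cube_familyM.
  - exact: cube_familyV.
  (* A single coordinate changes only along the direction of its block, by the factor [d]. *)
  - pose d := inv (e i) * a i; have adE : a i = e i * d by rewrite mulVKx.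
    exists (e i), (if val i == 0 then d else 1).
    exists (if val i == 1%N then d else 1).
    exists (if 1 < val i then d else 1), 1, 1, 1.
    split=> [|||[[w1 w2] w3]]; try exact: central1.
    rewrite /A /cube !pow1 !mulx1 adE.
    case: (val i) => [|[|m]] /=; rewrite !pow1 ?(mul1x, mulx1).
    + by case: w1; rewrite ?mulx1.
    + by case: w2; rewrite ?mulx1.
    + by case: w3; rewrite ?mulx1.
rewrite (@eval_ext _ _ p a (A (true, true, true)));
  last by move=> i; rewrite /A !if_same.
have cE w : w != (true, true, true) -> c = cube g0 g1 g2 g3 z12 z13 z23 w.
  by move=> wN; rewrite -AE Ac.
have /= := cE (false, false, false) isT; have /= := cE (true, false, false) isT.
have /= := cE (false, true, false) isT; have /= := cE (false, false, true) isT.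
have /= := cE (true, true, false) isT; have /= := cE (true, false, true) isT.
have /= := cE (false, true, true) isT; rewrite AE /=.
rewrite !(mul1x, mulx1) => E23 E13 E12 E3 E2 E1 E0.
have mulR1 x : c = c * x -> x = 1.
  by move=> cx; apply: (@mul_injl c); rewrite mulx1.
(* The bottom vertex gives [g0 = c], its three neighbours make the other [g]s trivial, and the
   vertices with two true bits then do so for the [z]s. *)
move: E1 E2 E3 E12 E13 E23; rewrite -E0.
do 3!move=> /mulR1 ->.
rewrite ?(mul1x, mulx1).
by do 3!move=> /mulR1 ->; rewrite ?(mul1x, mulx1).
Qed.

End Class2.
End GroupTheory.

Theorem proposition5p1 (Q : loop) :
  (supernilpotent Q 1 <-> is_abelian_group Q) /\
  (supernilpotent Q 2 <-> is_nilpotent_group Q 2).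
Proof.
split; split.
- move=> snQ; split; last exact: supernilpotent1_comm.
  exact: supernilpotent_group snQ.
- by case=> mulA; apply: abelian_supernilpotent1.
- move=> snQ; have mulA := supernilpotent_group (isT : 2 < 3) snQ.
  apply/(nilpotent2P mulA) => x y z; apply/commutator_eq1 => //.
  exact: supernilpotent2_commutator.
- move=> nilQ; apply: class2_supernilpotent2; first by case: nilQ.
  by apply/nilpotent2P => //; case: nilQ.
Qed.
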